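(* Let $\alpha>2$, $\lambda_E>0$, $N\ge 1$, let $A_1,\dots,A_{N+1}$ be distinct points of $\mathbb{R}^2$ (an $N$-hop path) and let $p_{A_1},\dots,p_{A_N}>0$ be transmit powers. Let $\Phi_E$ be the homogeneous Poisson point process of colluding eavesdroppers, with density $\lambda_E$ on $\mathbb{R}^2$, and let the channel coefficients be as in the context. Then the secure connection probability of the path for colluding eavesdroppers, $$\mathcal{P}_C=\mathcal{P}\left(\log_2\left(\frac{1+\min_{i=1,\dots,N}\left\{\frac{p_{A_i}|h_{A_iA_{i+1}}|^2}{d_{A_iA_{i+1}}^{\alpha}}\right\}}{1+\sum_{E_j\in\Phi_E}\sum_{k=1}^{N}\frac{p_{A_k}|h_{A_kE_j}|^2}{d_{A_kE_j}^{\alpha}}}\right)>0\right),$$ is given by $$\mathcal{P}_C=\exp\left[-\lambda_E\int_{\mathbb{R}^2}\left(1-\prod_{k=1}^{N}\frac{1}{1+\frac{p_{A_k}}{d_{A_k x}^{\alpha}}\sum_{i=1}^{N}\frac{d_{A_iA_{i+1}}^{\alpha}}{p_{A_i}}}\right)dx\right].$$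
   Context: $d_{XY}$ denotes the Euclidean distance between the points $X,Y\in\mathbb{R}^2$. $\Phi_E=\{E_j\}$ is a homogeneous Poisson point process on $\mathbb{R}^2$ with density $\lambda_E$. The squared magnitudes $|h_{A_iA_{i+1}}|^2$ ($i=1,\dots,N$) and $|h_{A_kE_j}|^2$ ($k=1,\dots,N$, $E_j\in\Phi_E$) are exponentially distributed with mean one, mutually independent and independent of $\Phi_E$. The integrand is defined for almost every $x\in\mathbb{R}^2$. *)

(* Defs.v *)
From HB Require Import structures.
From mathcomp Require Import all_boot all_order all_algebra.
From mathcomp Require Import finmap complex.
From mathcomp Require Import all_classical all_reals all_analysis.
From mathcomp Require Import measurable_realfun.

Set Implicit Arguments.
Unset Strict Implicit.
Unset Printing Implicit Defensive.

Import Order.TTheory GRing.Theory Num.Theory.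
Import numFieldNormedType.Exports.

Local Open Scope classical_set_scope.
Local Open Scope ring_scope.

Notation lebesgue2 R :=
  ((@lebesgue_measure R) \x (@lebesgue_measure R))%E (only parsing).

Definition eucl_dist (R : realType) (x y : R * R) : R :=
  Num.sqrt ((x.1 - y.1) ^+ 2 + (x.2 - y.2) ^+ 2).

(* Since x / +oo = 0 and lne 0 = -oo, the value at a ratio with infinite
   denominator is -oo. *)
Definition log2e (R : realType) (x : \bar R) : \bar R :=
  (lne x / (ln 2)%:E)%E.

Definition sqmag (R : realType) (z : R[i]) : R :=
  ComplexField.Normc.normc z ^+ 2.

Section probability_notions.
Context (d : measure_display) (T : measurableType d) (R : realType).
Variable P : probability T R.

Definition mutually_independent (I : choiceType) (F : I -> set (set T)) : Prop :=
  forall (J : {fset I}) (A : I -> set T),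
    (forall i, i \in J -> F i (A i)) ->
    P (\bigcap_(i in [set` J]) A i) = (\prod_(i <- J) P (A i))%E.

(* Unit rate, hence unit mean. *)
Definition exponential_mean1 (X : T -> R) : Prop :=
  measurable_fun setT X /\
  forall B : set R, measurable B -> P (X @^-1` B) = exponential_prob 1 B.

Definition sigma_of_sequence (d' : measure_display) (T' : measurableType d')
    (E : nat -> T -> T') : set (set T) :=
  <<s \bigcup_j g_sigma_algebra_preimage (E j) >>.

(* Number of points (with multiplicity) in B of the process E(w) = {E_j(w)}. *)
Definition npoints (E : nat -> T -> R * R) (B : set (R * R)) (w : T) : \bar R :=
  counting [set j | B (E j w)].

(* A homogeneous Poisson process on the plane has almost surely infinitely many
   points, so it is given by a measurable enumeration E_0, E_1, ... of them.
   The second argument of poisson_prob is a dummy. For rate 0 poisson_prob is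
   the Dirac mass at 0 (poisson_pmf would be constantly 1 there), as is needed
   for Lebesgue-null B. *)
Definition homogeneous_poisson_process (lambda : R) (E : nat -> T -> R * R) : Prop :=
  [/\ forall j, measurable_fun setT (E j),
      forall B : set (R * R), measurable B -> (lebesgue2 R B < +oo)%E ->
        forall n : nat,
          P [set w | npoints E B w = n%:R%:E] =
          poisson_prob (lambda * fine (lebesgue2 R B)) 0%N [set n]
    & forall (m : nat) (B : 'I_m -> set (R * R)),
        (forall i, measurable (B i)) -> trivIset setT B ->
        mutually_independent (fun i =>
          g_sigma_algebra_preimage (npoints E (B i)))].

End probability_notions.

Section network.
Context (T : Type) (R : realType) (N : nat).
Variables (alpha : R) (A : 'I_N.+1 -> R * R) (p : 'I_N -> R).
(* hL i is the coefficient of the i-th hop and hE k j the one from the k-th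
   transmitter to the j-th eavesdropper, located at E j. *)
Variables (hL : 'I_N -> T -> R[i]) (hE : 'I_N -> nat -> T -> R[i]).
Variable E : nat -> T -> R * R.

(* The i-th hop goes from transmitter i to receiver i; the last node of the path
   only receives. *)
Definition transmitter (i : 'I_N) : R * R := A (widen_ord (leqnSn N) i).
Definition receiver (i : 'I_N) : R * R := A (lift ord0 i).

Definition hop_loss (i : 'I_N) : R :=
  eucl_dist (transmitter i) (receiver i) `^ alpha.

(* +oo is the neutral element of the minimum, which is finite for N > 0. *)
Definition min_hop_snr (w : T) : \bar R :=
  \big[Order.min/+oo%E]_(i < N) (p i * sqmag (hL i w) / hop_loss i)%:E.

(* A summand with E j w = transmitter k is 0 by the convention x / 0 = 0; this
   happens with probability 0. *)
Definition eavesdropper_snr (w : T) : \bar R :=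
  (\sum_(0 <= j <oo) \sum_(k < N)
     (p k * sqmag (hE k j w) / eucl_dist (transmitter k) (E j w) `^ alpha)%:E)%E.

Definition colluding_secure_connection : set T :=
  [set w | (0 < log2e ((1 + min_hop_snr w) / (1 + eavesdropper_snr w)))%E].

(* Every |h|^2, of a hop or of an eavesdropper. *)
Definition channel_gain (c : 'I_N + 'I_N * nat) : T -> R :=
  match c with
  | inl i => fun w => sqmag (hL i w)
  | inr (k, j) => fun w => sqmag (hE k j w)
  end.

End network.

(* The sigma-algebra of the whole sequence E (index None) together with those of
   the single gains (indices Some c). Independence is from the enumerated process,
   so that the gains attached to the points are not correlated with the way the
   points are labelled. *)
Definition process_gain_sigma (d : measure_display) (T : measurableType d)
    (R : realType) (N : nat)
    (hL : 'I_N -> T -> R[i]) (hE : 'I_N -> nat -> T -> R[i])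
    (E : nat -> T -> R * R) (o : option ('I_N + 'I_N * nat)) : set (set T) :=
  match o with
  | None => sigma_of_sequence E
  | Some c => g_sigma_algebra_preimage (channel_gain hL hE c)
  end.

(* Main.v *)
Require Import Defs.
From HB Require Import structures.
From mathcomp Require Import all_boot all_order all_algebra.
From mathcomp Require Import finmap complex.
From mathcomp Require Import all_classical all_reals all_analysis.
From mathcomp Require Import measurable_realfun.
From mathcomp Require Import ring lra.

Set Implicit Arguments.
Unset Strict Implicit.
Unset Printing Implicit Defensive.

Import Order.TTheory GRing.Theory Num.Theory.
Import numFieldNormedType.Exports.

Local Open Scope classical_set_scope.
Local Open Scope ring_scope.

(* Write c_i for the loss of hop i divided by its power, S for the sum of the
   c_i and I for the sum over the eavesdroppers. The connection is secure iff
   c_i I < |h_i|^2 for every hop i. The exponential gains of the hops are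
   independent of I, so integrating them out one at a time gives
   P_C = E exp(-S I). Integrating out the gains of the eavesdroppers in the same
   way turns this into E prod_j f(E_j), f being the product over k in the
   integrand of the theorem, that is into the Laplace functional of the Poisson
   process at -ln f. For a simple function supported on a set of finite measure
   that functional is computed from the independent Poisson counts of the level
   sets; the general case follows by monotone approximation. *)

(** * Independence of generated sigma-algebras *)

Section independence.
Context d (T : measurableType d) (R : realType) (P : probability T R).
Local Open Scope ereal_scope.

Definition joint_sigma (I : Type) (F : I -> set (set T)) (J : set I) :
    set (set T) :=
  <<s \bigcup_(i in J) F i >>.

Definition indep_events (X Y : set T) : Prop := P (X `&` Y) = P X * P Y.

(** The lambda-system half of the pi-lambda argument below. Measurability belongs to the class
    because closure under complements and disjoint unions relies on it. *)
Lemma indep_events_dynkin (Y : set T) : measurable Y ->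
  dynkin [set X | measurable X /\ indep_events X Y].
Proof.
move=> mY; split.
- by split=> //; rewrite /indep_events setTI probability_setT mul1e.
- move=> X [mX XY]; split; first exact: measurableC.
  rewrite /indep_events probability_setC// setIC -setDE measureD//; last first.
    by rewrite (le_lt_trans (probability_le1 P mY)) ?ltry.
  move: XY; rewrite /indep_events setIC => XY.
  transitivity (P Y - P X * P Y); first by congr (_ - _).
  by rewrite muleBl ?mul1e ?fin_num_measure// fin_num_adde_defr.
- move=> F tF FY; have mF n : measurable (F n) by case: (FY n).
  split; first exact: bigcup_measurable.
  rewrite /indep_events setI_bigcupl measure_bigcup//=; last 2 first.
    by move=> k _; exact: measurableI.
    exact: trivIset_setIr.
  rewrite measure_bigcup//= muleC.
  have [y PY] : exists y, P Y = y%:E.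
    by exists (fine (P Y)); rewrite fineK// fin_num_measure.
  rewrite PY -nneseriesZl//.
  by apply: eq_eseriesr => k _; rewrite (FY k).2 PY muleC.
Qed.

(** Finite intersections of events taken from the [F i], [i] in [J], form a pi-system that generates
    the joint sigma-algebra. On it the product formula is an instance of mutual independence, and
    the pi-lambda theorem extends it. *)
Lemma indep_joint_sigma (I : choiceType) (F : I -> set (set T)) (J : set I)
    (c : I) (X Y : set T) :
  (forall i, sigma_algebra setT (F i)) -> (forall i, F i `<=` measurable) ->
  mutually_independent P F -> ~ J c ->
  joint_sigma F J X -> F c Y -> indep_events X Y.
Proof.
move=> sF mF indF Jc JX FY; have mY := mF _ _ FY.
have FT i : F i setT.
  by have [F0 FC _] := sF i; rewrite -setC0 -setTD; exact: FC.
have FI i : setI_closed (F i).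
  rewrite -(measurable_g_measurableTypeE (sF i)).
  exact: (@measurableI _ (g_sigma_algebraType (F i))).
pose Pi : set (set T) := [set Z | exists (K : {fset I}) (A : I -> set T),
  [/\ {in K, forall i, J i}, forall i, F i (A i) &
      Z = \bigcap_(i in [set` K]) A i]].
have PiI : setI_closed Pi.
  move=> _ _ [K1 [A1 [K1J FA1 ->]]] [K2 [A2 [K2J FA2 ->]]].
  (* Padding each family by [setT] outside its index set lets the two be intersected index by index
     over the union. *)
  pose B (K : {fset I}) (A : I -> set T) i := if i \in K then A i else setT.
  exists (K1 `|` K2)%fset, (fun i => B K1 A1 i `&` B K2 A2 i); split.
  - by move=> i; rewrite inE => /orP[/K1J|/K2J].
  - by move=> i; apply: FI; rewrite /B; case: ifPn.
  - apply/seteqP; split=> [w [w1 w2] i /= iK|w wB].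
      by split; rewrite /B; case: ifPn => // ?; [exact: w1|exact: w2].
    split=> i /= iK.
      by have /= := wB i; rewrite inE iK => /(_ isT)[]; rewrite /B iK.
    by have /= := wB i; rewrite inE iK orbT => /(_ isT)[]; rewrite /B iK.
have : <<s Pi >> X.
  move: JX; apply: sub_smallest2r; first exact: smallest_sigma_algebra.
  move=> Z [i Ji FZ].
  exists [fset i]%fset, (fun j => if j == i then Z else setT); split.
  - by move=> j; rewrite inE => /eqP ->.
  - by move=> j; case: eqP => [->|].
  - by rewrite set_fset1 bigcap_set1 eqxx.
rewrite -setI_closed_g_dynkin_g_sigma_algebra//.
suff sub : <<d Pi >> `<=` [set X | measurable X /\ indep_events X Y].
  by move=> /sub[].
apply: smallest_sub; first exact: indep_events_dynkin.
move=> _ [K [A [KJ FA ->]]]; split.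
  by apply: fin_bigcap_measurable => // i _; exact: mF.
have cK : c \notin K by apply/negP => /KJ.
(* Mutual independence over [K] enlarged by [c], with [Y] in position [c]. Since [c] is not in [K],
   the factor [P Y] splits off and the product over [K] remains. *)
have := indF (c |` K)%fset (fun i => if i == c then Y else A i).
rewrite /indep_events big_fsetU1//= eqxx => HY.
have AE i : i \in K -> (if i == c then Y else A i) = A i.
  by case: eqP => // ->; rewrite (negbTE cK).
rewrite muleC (indF K A)//.
under eq_big_seq => i iK do rewrite -(AE i iK).
rewrite -HY; last by move=> i _; case: eqP => // ->.
congr (P _); rewrite set_fsetU1 bigcap_setU1 eqxx setIC; congr (_ `&` _).
by apply: eq_bigcapr => i /AE.
Qed.

End independence.

(** * Integrating out independent variables *)

Section integral_indep.
Context d (T : measurableType d) (R : realType) (P : probability T R).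
Local Open Scope ereal_scope.

(** By independence the law of the pair agrees with the product of the two laws on rectangles, hence
    everywhere, and Tonelli splits the integral. The variable [v] acts as an independent copy of
    [w]. *)
Lemma integral_indep_pair d1 d2 (T1 : measurableType d1)
    (T2 : measurableType d2) (U : T -> T1) (g : T -> T2)
    (phi : T1 * T2 -> \bar R) :
  measurable_fun setT U -> measurable_fun setT g ->
  (forall A B, measurable A -> measurable B ->
    indep_events P (U @^-1` A) (g @^-1` B)) ->
  measurable_fun setT phi -> (forall x, 0 <= phi x) ->
  \int[P]_w phi (U w, g w) = \int[P]_w \int[P]_v phi (U w, g v).
Proof.
move=> mU mg indUg mphi phi0.
pose U' : {mfun T >-> T1} := HB.pack U (isMeasurableFun.Build _ _ _ _ _ mU).
pose g' : {mfun T >-> T2} := HB.pack g (isMeasurableFun.Build _ _ _ _ _ mg).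
have mUg : measurable_fun setT (fun w => (U w, g w)).
  exact: measurable_fun_pair.
pose Ug : {mfun T >-> (T1 * T2)%type} :=
  HB.pack (fun w => (U w, g w)) (isMeasurableFun.Build _ _ _ _ _ mUg).
have lawE A : measurable A ->
    (distribution P U' \x distribution P g') A = distribution P Ug A.
  by apply: product_measure_unique => A1 A2 mA1 mA2; exact: indUg.
transitivity (\int[distribution P Ug]_x phi x).
  by rewrite ge0_integral_distribution.
transitivity (\int[distribution P U' \x distribution P g']_x phi x).
  by apply: eq_measure_integral => A mA _; apply/esym; exact: lawE.
rewrite fubini_tonelli1// ge0_integral_distribution//=; last 2 first.
- exact: measurable_fun_fubini_tonelli_F.
- by move=> x; apply: integral_ge0.
apply: eq_integral => w _; rewrite /= /fubini_F ge0_integral_distribution//.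
exact: measurable_fun_pair2.
Qed.

Lemma measurable_joint_sigmaS d1 (T1 : measurableType d1) (I : Type)
    (F : I -> set (set T)) (J K : set I) (f : T -> T1) : J `<=` K ->
  measurable_fun
    (setT : set (g_sigma_algebraType (\bigcup_(i in J) F i))) f ->
  measurable_fun
    (setT : set (g_sigma_algebraType (\bigcup_(i in K) F i))) f.
Proof.
move=> JK mf _ Y mY; have := mf measurableT Y mY.
by apply: sub_sigma_algebra2; exact: bigcup_subset.
Qed.

Lemma measurable_joint_sigma1 d1 (T1 : measurableType d1) (I : Type)
    (F : I -> set (set T)) (J : set I) (c : I) (f : T -> T1) : J c ->
  (forall B, measurable B -> F c (f @^-1` B)) ->
  measurable_fun
    (setT : set (g_sigma_algebraType (\bigcup_(i in J) F i))) f.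
Proof.
move=> Jc Ff _ B mB; rewrite setTI; apply: sub_sigma_algebra.
by exists c => //; exact: Ff.
Qed.

Lemma measurable_joint_sigmaT d1 (T1 : measurableType d1) (I : Type)
    (F : I -> set (set T)) (J : set I) (f : T -> T1) :
  (forall i, F i `<=` measurable) ->
  measurable_fun
    (setT : set (g_sigma_algebraType (\bigcup_(i in J) F i))) f ->
  measurable_fun setT f.
Proof.
move=> mF mf _ Y mY; have : joint_sigma F J (setT `&` f @^-1` Y) by exact: mf.
apply: smallest_sub; first exact: sigma_algebra_measurable.
by move=> Z [i _]; exact: mF.
Qed.

(** Induction on [s]: the first variable is independent of all other data in the integrand and can
    be averaged alone. The weight [W] is there for the induction: it absorbs the averaged factor, a
    function of [U c], and stays measurable for the indices in [J]. *)
Lemma integral_prod_indep (I : choiceType) (F : I -> set (set T))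
    d1 d2 (T1 : measurableType d1) (T2 : measurableType d2)
    (g : I -> T -> T2) (phi : T1 * T2 -> \bar R) (J : set I) (s : seq I)
    (U : I -> T -> T1) (W : T -> \bar R) :
  (forall i, sigma_algebra setT (F i)) -> (forall i, F i `<=` measurable) ->
  mutually_independent P F ->
  uniq s -> {in s, forall c, ~ J c} ->
  {in s, forall c B, measurable B -> F c (g c @^-1` B)} ->
  measurable_fun setT phi -> (forall x, 0 <= phi x) ->
  (forall c, measurable_fun
    (setT : set (g_sigma_algebraType (\bigcup_(i in J) F i))) (U c)) ->
  measurable_fun
    (setT : set (g_sigma_algebraType (\bigcup_(i in J) F i))) W ->
  (forall w, 0 <= W w) ->
  \int[P]_w (W w * \prod_(c <- s) phi (U c w, g c w)) =
  \int[P]_w (W w * \prod_(c <- s) \int[P]_v phi (U c w, g c v)).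
Proof.
move=> sF mF indF + + + mphi phi0 mU.
elim: s W => [|c s IH] W us sJ Fg mW W0.
  by apply: eq_integral => w _; rewrite !big_nil.
move: us => /= /andP[cs us].
have mgT c' : c' \in c :: s -> measurable_fun setT (g c').
  by move=> c's _ B mB; rewrite setTI; apply: mF; exact: Fg.
pose K := J `|` [set` s].
pose TK := g_sigma_algebraType (\bigcup_(i in K) F i).
pose V (w : TK) : \bar R := W w * \prod_(c' <- s) phi (U c' w, g c' w).
have mV : measurable_fun setT V.
  apply: emeasurable_funM.
    by apply: measurable_joint_sigmaS mW; left.
  suff mprod s' : {subset s' <= s} -> measurable_fun setT
    (fun w : TK => \prod_(c' <- s') phi (U c' w, g c' w)) by exact: mprod.
  elim: s' => [|c' s' IHs] ss'.
    apply: (eq_measurable_fun (cst 1)) => [w _|]; first by rewrite big_nil.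
    exact: measurable_cst.
  apply: (eq_measurable_fun (fun w : TK => phi (U c' w, g c' w) *
      \prod_(c' <- s') phi (U c' w, g c' w))) => [w _|].
    by rewrite big_cons.
  apply: emeasurable_funM; last first.
    by apply: IHs => x xs'; apply: ss'; rewrite inE xs' orbT.
  have c's : c' \in s by apply: ss'; rewrite inE eqxx.
  apply: (measurableT_comp mphi); apply: measurable_fun_pair.
    by apply: measurable_joint_sigmaS (mU c'); left.
  apply: (@measurable_joint_sigma1 _ _ _ _ _ c'); first by right.
  by apply: Fg; rewrite inE c's orbT.
have V0 w : 0 <= V w by rewrite mule_ge0// prode_ge0.
(* With the identity into [TK] as first component, [integral_indep_pair] treats everything
   measurable for the indices in [K] as one random element independent of [g c]. *)
have mid : measurable_fun setT (id : T -> TK).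
  exact: (@measurable_joint_sigmaT _ TK _ F K id mF (@measurable_id _ TK _)).
pose Phi (x : TK * T2) := V x.1 * phi (U c x.1, x.2).
have mUK : measurable_fun setT (U c : TK -> T1).
  by apply: measurable_joint_sigmaS (mU c); left.
have mPhi : measurable_fun setT Phi.
  apply: emeasurable_funM; first exact: measurableT_comp.
  apply: (measurableT_comp mphi); apply: measurable_fun_pair => //.
  exact: measurableT_comp.
transitivity (\int[P]_w Phi (w, g c w)).
  by apply: eq_integral => w _; rewrite big_cons /Phi /V /= muleCA muleC.
rewrite (integral_indep_pair mid (mgT c _) _ mPhi); last 3 first.
- by rewrite inE eqxx.
- move=> A B mA mB.
  apply: (@indep_joint_sigma _ _ _ _ _ F K c) => //.
    by move=> [/sJ|/=]; [rewrite inE eqxx => /(_ isT)|rewrite (negbTE cs)].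
  by apply: Fg => //; rewrite inE eqxx.
- by move=> x; rewrite /Phi mule_ge0.
(* Averaging [g c] leaves [psi c (U c)]; the weight for the induction hypothesis is [W] times this
   factor. *)
pose psi c' (u : T1) := \int[P]_v phi (u, g c' v).
have mpsi : measurable_fun setT (psi c).
  apply: (@measurable_fun_fubini_tonelli_F _ _ _ _ _ P
    (fun x => phi (x.1, g c x.2))) => //.
  apply: (measurableT_comp mphi); apply: measurable_fun_pair => //.
  by apply: measurableT_comp => //; apply: mgT; rewrite inE eqxx.
have psi0 u : 0 <= psi c u by apply: integral_ge0.
transitivity (\int[P]_w ((W w * psi c (U c w)) *
    \prod_(c' <- s) phi (U c' w, g c' w))).
  apply: eq_integral => w _; rewrite /Phi /= ge0_integralZl//; last first.
    apply: (measurableT_comp mphi); apply: measurable_fun_pair => //.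
    by apply: mgT; rewrite inE eqxx.
  by rewrite /V -/(psi c (U c w)) muleAC.
rewrite IH//.
- by apply: eq_integral => w _; rewrite big_cons muleA.
- by move=> x xs; apply: sJ; rewrite inE xs orbT.
- by move=> x xs; apply: Fg; rewrite inE xs orbT.
- by apply: emeasurable_funM => //; exact: measurableT_comp.
- by move=> w; rewrite mule_ge0.
Qed.

End integral_indep.

(** * The exponential on the extended reals *)

Section expeR_extra.
Context (R : realType).
Local Open Scope ereal_scope.

Lemma measurable_expeR : measurable_fun setT (@expeR R).
Proof.
(* At the infinite values [maxe x 0] coincides with [expeR]: it is +oo at +oo and 0 at -oo. *)
apply: (eq_measurable_fun (fun x : \bar R => if x \is a fin_num
  then (expR (fine x))%:E else maxe x 0)) => [[r| |] _//=|].
  by rewrite max_r ?leNye.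
apply: measurable_fun_ifT.
- apply: (measurable_fun_bool true).
  exact: (emeasurable_fin_num measurableT (@measurable_id _ _ _)).
- by apply/measurable_EFinP; apply: measurableT_comp.
- exact: measurable_maxe.
Qed.

Lemma expeRN_le1 (x : \bar R) : 0 <= x -> expeR (- x) <= 1.
Proof. by move=> x0; rewrite -expeR0 lee_expeR leeNl oppe0. Qed.

Lemma expeRN_sum (I : Type) (s : seq I) (f : I -> \bar R) :
  (forall i, 0 <= f i) ->
  expeR (- \sum_(i <- s) f i) = \prod_(i <- s) expeR (- f i).
Proof.
move=> f0; elim: s => [|i s IH]; first by rewrite !big_nil oppe0 expeR0.
rewrite !big_cons -IH oppeD ?expeRD//.
by apply: ge0_adde_def; rewrite inE ?sume_ge0.
Qed.

(** Continuity of exp(-x) on [0, +oo] with the infinite endpoint included, since the sums over the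
    points of the process may diverge. *)
Lemma cvg_expeRN (u : (\bar R)^nat) (l : \bar R) :
  (forall n, 0 <= u n) -> u @ \oo --> l ->
  expeR (- u n) @[n --> \oo] --> expeR (- l).
Proof.
move=> u0; case: l => [l|uy|uNy]; last first.
- have : 0 <= -oo :> \bar R.
    rewrite -(cvg_lim _ uNy)//.
    by apply: lime_ge; [apply/cvg_ex; exists -oo|exact: nearW].
  by [].
- apply/fine_cvgP; split.
    apply: nearW => n; rewrite ge0_fin_numE ?expeR_ge0//.
    by rewrite (le_lt_trans (expeRN_le1 (u0 n)))// ltry.
  (* The threshold [- ln e] is chosen so that [u n] above it gives exp(-[u n]) at most [e]. *)
  apply/cvgr0Pnorm_le => e e0; move/cvgeyPge : uy => /(_ (- ln e)%R).
  apply: filterS => n eu /=.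
  have : - u n <= (ln e)%:E by rewrite leeNl -EFinN.
  rewrite -lee_expeR /= lnK// => ule.
  have fin_expR : expeR (- u n) \is a fin_num.
    by rewrite ge0_fin_numE ?expeR_ge0// (le_lt_trans ule)// ltry.
  by rewrite ger0_norm ?fine_ge0 ?expeR_ge0// -lee_fin fineK.
- move=> /fine_cvgP[ufin ul]; apply/fine_cvgP; split.
    by apply: filterS ufin => n; case: (u n).
  have : expR (- (fine \o u) n) @[n --> \oo] --> expR (- l).
    by apply: continuous_cvg; [exact: continuous_expR|exact: cvgN].
  apply: cvg_trans; apply: near_eq_cvg.
  by apply: filterS ufin => n /=; case: (u n).
Qed.

Lemma measurable_expeRN d (T : measurableType d) (f : T -> \bar R) :
  measurable_fun setT f -> measurable_fun setT (fun w => expeR (- f w)).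
Proof.
move=> mf; apply: (@measurableT_comp _ _ _ _ _ _ (@expeR R) setT (fun w => - f w)).
  exact: measurable_expeR.
exact: measurableT_comp.
Qed.

(** Dominated convergence with the constant bound 1, integrable for a probability. It serves both
    for partial sums over the points and for truncated functions. *)
Lemma cvg_integral_expeRN d (T : measurableType d) (P : probability T R)
    (u : (T -> \bar R)^nat) (v : T -> \bar R) :
  (forall n, measurable_fun setT (u n)) -> (forall n w, 0 <= u n w) ->
  (forall w, u ^~ w @ \oo --> v w) ->
  \int[P]_w expeR (- u n w) @[n --> \oo] --> \int[P]_w expeR (- v w).
Proof.
move=> mu u0 uv.
have mv : measurable_fun setT v.
  by apply: (emeasurable_fun_cvg u) => // w _; exact: uv.
have [] := @dominated_convergence _ _ _ P setT measurableT
  (fun n w => expeR (- u n w)) (fun w => expeR (- v w)) (cst 1).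
- by move=> n; exact: measurable_expeRN.
- exact: measurable_expeRN.
- by apply: aeW => w _; apply: cvg_expeRN (uv w) => n; exact: u0.
- exact: finite_measure_integrable_cst.
- apply: aeW => w n _; rewrite gee0_abs ?expeR_ge0//.
  exact: expeRN_le1.
- by [].
Qed.

End expeR_extra.

(** * Tail and Laplace transform of the exponential law *)

Section exponential_law.
Context (R : realType).
Local Notation mu := (@lebesgue_measure R).
Local Open Scope ereal_scope.

Lemma exponential_prob_tail (rate x : R) : (0 < rate)%R -> (0 <= x)%R ->
  exponential_prob rate `[x, +oo[ = (expR (- (rate * x)))%:E.
Proof.
move=> rate0 x0.
have cexp (c : R) : continuous (fun z : R => expR (c * z)).
  move=> z; apply: continuous_comp; last exact: continuous_expR.
  exact: mulrl_continuous.
rewrite /exponential_prob (@ge0_continuous_FTC2y _ _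
  (fun s => - (expR (- rate * s)))%R _ 0)//.
- by rewrite EFinN oppeK add0e mulNr.
- by move=> s _; apply: exponential_pdf_ge0; exact: ltW.
- apply: (@continuous_subspaceW R^o _ _ [set` `[0%R, +oo[%R]).
    by apply: subset_itvr; rewrite bnd_simp.
  exact: within_continuous_exponential_pdf.
- rewrite -oppr0; apply: cvgN.
  rewrite (_ : (fun x => expR (- rate * x)) =
               (fun z => expR (- z)) \o (fun z => rate * z))%R; last first.
    by apply: eq_fun => y; rewrite mulNr.
  apply: (@cvg_comp _ _ _ _ _ _ (pinfty_nbhs R)); last exact: cvgr_expR.
  exact: gt0_cvgMry.
- by apply: cvgN; apply/cvg_at_right_filter; exact: cexp.
- move=> s; rewrite in_itv/= andbT => xs.
  by apply: derive1_exponential_pdf; rewrite in_itv/= andbT (le_lt_trans x0).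
Qed.

Context d (T : measurableType d) (P : probability T R) (X : T -> R).
Hypotheses (X_exp : exponential_mean1 P X) (X_ge0 : forall w, (0 <= X w)%R).

Lemma exponential_mean1_ge (x : R) : (0 <= x)%R ->
  P [set w | (x <= X w)%R] = (expR (- x))%:E.
Proof.
move=> x0; have := exponential_prob_tail ltr01 x0; rewrite mul1r => <-.
rewrite -X_exp.2//; congr (P _); apply/seteqP.
by split=> w /=; rewrite in_itv/= andbT.
Qed.

Lemma exponential_mean1_gt (x : R) : (0 <= x)%R ->
  P [set w | (x < X w)%R] = (expR (- x))%:E.
Proof.
move=> x0; have := exponential_prob_tail ltr01 x0; rewrite mul1r => <-.
rewrite /exponential_prob -integral_itv_obnd_cbnd//; last first.
  by apply/measurable_funTS/measurable_EFinP; exact: measurable_exponential_pdf.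
rewrite -[RHS]X_exp.2//; congr (P _); apply/seteqP.
by split=> w /=; rewrite in_itv/= andbT.
Qed.

(* exp(-uX) is the mass that the exponential law of rate u gives to ]X, +oo[;
   integrating over the probability space first leaves the integral of
   u exp(-us) (1 - exp(-s)). *)
Lemma exponential_mean1_laplace (u : R) : (0 <= u)%R ->
  \int[P]_w (expR (- (u * X w)))%:E = ((1 + u)^-1)%:E.
Proof.
rewrite le_eqVlt => /predU1P[<-|u0].
  under eq_integral do rewrite mul0r oppr0 expR0.
  by rewrite integral_cst// mul1e addr0 invr1; exact: probability_setT.
have mX : measurable_fun setT X := X_exp.1.
pose f (z : T * R) := ((exponential_pdf u z.2) *
  \1_[set z : T * R | X z.1 < z.2] z)%:E.
have mf : measurable_fun setT f.
  apply/measurable_EFinP/measurable_funM.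
    by apply: measurableT_comp => //; apply: measurable_exponential_pdf.
  apply: measurable_indic.
  have : measurable_fun setT (fun z : T * R => X z.1 < z.2)%R.
    by apply: measurable_fun_ltr => //; exact: measurableT_comp.
  by move=> mlt; rewrite -[X in measurable X]setTI; apply: (mlt _ [set true]).
have f0 z : 0 <= f z.
  by rewrite lee_fin mulr_ge0// exponential_pdf_ge0// ltW.
transitivity (\int[P]_w \int[mu]_s f (w, s)).
  apply: eq_integral => w _; rewrite -exponential_prob_tail//.
  rewrite /exponential_prob -integral_itv_obnd_cbnd//; last first.
    apply/measurable_funTS/measurable_EFinP.
    exact: measurable_exponential_pdf.
  rewrite integral_mkcond; apply: eq_integral => s _.
  rewrite patchE /f /= indicE; case: ifPn => [/set_mem/=|/negP sX].
    by rewrite in_itv/= andbT => sX; rewrite mem_set// mulr1.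
  rewrite memNset ?mulr0//= => Xs; apply: sX.
  by rewrite inE/= in_itv/= andbT.
rewrite (@fubini_tonelli _ _ _ _ _ P mu f mf f0).
(* Since P(X < s) = 1 - exp(-s), the inner integral is u exp(-us) - u exp(-(1+u)s). The second term
   is u / (1+u) times the density of rate 1+u, so the total is 1 - u / (1+u). *)
have -> : \int[mu]_s \int[P]_w f (w, s) = \int[mu]_s
  (exponential_pdf u s - u / (1 + u) * exponential_pdf (1 + u) s)%:E.
  apply: eq_integral => s _; rewrite /f /=.
  have [s0|s0] := ltP s 0%R.
    rewrite !lt0_exponential_pdf// mulr0 subr0.
    by under eq_integral do rewrite mul0r; rewrite integral0.
  under eq_integral do rewrite EFinM.
  have mXs : measurable [set w | (X w < s)%R].
    have mlt : measurable_fun setT (fun w => X w < s)%R.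
      exact: measurable_fun_ltr.
    by rewrite -[X in measurable X]setTI; apply: (mlt _ [set true]).
  rewrite ge0_integralZl//; last 2 first.
  - by apply/measurable_EFinP; exact: measurable_indic mXs.
  - by rewrite lee_fin exponential_pdf_ge0// ltW.
  transitivity ((exponential_pdf u s)%:E * P [set w | (X w < s)%R]).
    by congr (_ * _); rewrite (integral_indic _ _ mXs) ?setIT.
  have -> : P [set w | (X w < s)%R] = (1 - expR (- s))%:E.
    rewrite EFinB -(exponential_mean1_ge s0) -probability_setC.
      by congr (P _); apply/seteqP; split=> w /=; rewrite ltNge => /negP.
    have mle : measurable_fun setT (fun w => s <= X w)%R.
      exact: measurable_fun_ler.
    by rewrite -[X in measurable X]setTI; apply: (mle _ [set true]).
  rewrite -EFinM; congr EFin.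
  rewrite !exponential_pdfE// mulrBr mulr1; congr (_ - _)%R.
  rewrite mulrA divfK ?gt_eqF ?ltr_wpDl//.
  by rewrite -mulrA -expRD; congr (_ * expR _)%R; ring.
rewrite integralB_EFin//; last 2 first.
- exact: integrable_exponential_pdf.
- apply: (eq_integrable _ (fun s : measurableTypeR R =>
    (u / (1 + u))%:E * (EFin \o exponential_pdf (1 + u)) s)).
  - by [].
  - by move=> s _; rewrite /= EFinM.
  apply: integrableZl => //.
  by apply: integrable_exponential_pdf; rewrite ltr_wpDl.
under [X in _ - X]eq_integral do rewrite EFinM.
rewrite ge0_integralZl//; last 3 first.
- by apply/measurable_EFinP; exact: measurable_exponential_pdf.
- by move=> x _; rewrite lee_fin exponential_pdf_ge0// addr_ge0// ltW.
- by rewrite lee_fin divr_ge0// ?addr_ge0// ltW.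
rewrite !integral_exponential_pdf ?ltr_wpDl// mule1 -EFinB; congr EFin.
by field; rewrite gt_eqF// ltr_wpDl.
Qed.

End exponential_law.

(** * Laplace transform of the Poisson law *)

Section poisson_law.
Context (R : realType) d (T : measurableType d) (P : probability T R).
Local Open Scope ereal_scope.

(** Exponential tilting: the weight exp(-an) turns r^n into (r exp(-a))^n, and the prefactor
    corrects the normalisation from exp(-r) to that of the new rate. At rate 0 both laws are the
    Dirac mass at 0. *)
Lemma poisson_prob_thin (r a : R) (n : nat) : (0 <= r)%R ->
  (expR (- (a * n%:R)))%:E * poisson_prob r 0%N [set n] =
  (expR (- (r * (1 - expR (- a)))))%:E *
    poisson_prob (r * expR (- a)) 0%N [set n].
Proof.
rewrite le_eqVlt => /predU1P[<-|r0].
  rewrite /poisson_prob !mul0r ltxx oppr0 expR0 mul1e !diracE.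
  have [n0|n0] := eqVneq n 0%N; last first.
    by rewrite memNset ?mule0//= => /esym/eqP; rewrite (negbTE n0).
  by rewrite n0 mulr0 oppr0 expR0 mul1e.
rewrite /poisson_prob r0 mulr_gt0 ?expR_gt0// !esum_set1 ?lee_fin ?poisson_pmf_ge0//.
rewrite /poisson_pmf r0 mulr_gt0 ?expR_gt0// -!EFinM; congr EFin.
rewrite exprMn -expRM_natr mulrBr mulr1 opprB expRD mulNr.
rewrite -[LHS]mulr1 -(expRxMexpNx_1 (r * expR (- a))); ring.
Qed.

(** The Poisson masses add up to 1, so [N] is almost surely a natural number and the integral is a
    sum over its level sets. After tilting, the masses of rate r exp(-a) again add up to 1 and only
    the prefactor is left. *)
Lemma poisson_laplace (N : T -> \bar R) (r a : R) :
  (0 <= r)%R -> measurable_fun setT N -> (forall w, 0 <= N w) ->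
  (forall n : nat, P [set w | N w = n%:R%:E] = poisson_prob r 0%N [set n]) ->
  \int[P]_w expeR (- (a%:E * N w)) = (expR (- (r * (1 - expR (- a)))))%:E.
Proof.
move=> r0 mN N0 lawN.
pose D n := [set w | N w = n%:R%:E].
have mD n : measurable (D n).
  by rewrite -[D n]setTI; exact: (mN measurableT [set _]).
have tD : trivIset setT D.
  by apply/trivIsetP => i j _ _ ij; apply/seteqP; split=> // w [];
     rewrite /D /= => -> [] /eqP; rewrite eqr_nat (negbTE ij).
have poisson1 (s : R) : \sum_(n <oo) poisson_prob s 0%N [set n] = 1.
  have tS : trivIset setT (@set1 nat).
    by apply/trivIsetP => i j _ _ ij; apply/seteqP; split=> // k [/= ->] /eqP;
       rewrite (negbTE ij).
  have <- := @probability_setT _ _ _ (poisson_prob s 0%N).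
  have -> : [set: nat] = \bigcup_n [set n].
    by apply/seteqP; split=> // k _; exists k.
  by rewrite measure_bigcup//=; apply: eq_eseriesl => n; rewrite in_setT.
have mUD : measurable (\bigcup_n D n) by exact: bigcup_measurable.
have PD : P (\bigcup_n D n) = 1.
  rewrite measure_bigcup//= -[RHS](poisson1 r).
  rewrite (@eq_eseriesl _ _ xpredT) => [|n]; last by rewrite in_setT.
  by apply: eq_eseriesr => n _; exact: lawN.
have mf : measurable_fun setT (fun w => expeR (- (a%:E * N w))).
  by apply: measurable_expeRN; exact: emeasurable_funM.
have f0 w : 0 <= expeR (- (a%:E * N w)) by exact: expeR_ge0.
rewrite -(setUv (\bigcup_n D n)) ge0_integral_setU//=; last 3 first.
- exact: measurableC.
- by rewrite setUv.
- exact/disj_setPCl.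
rewrite [X in _ + X]null_set_integral ?adde0//; last 3 first.
- exact: measurableC.
- exact: measurable_funTS.
- by have := probability_setC P mUD; rewrite PD subee.
rewrite ge0_integral_bigcup//; last exact: measurable_funTS.
transitivity (\sum_(n <oo) (expR (- (r * (1 - expR (- a)))))%:E *
    poisson_prob (r * expR (- a)) 0%N [set n]); last first.
  rewrite nneseriesZl; last by move=> n _; exact: measure_ge0.
  by rewrite [X in _ * X]poisson1 mule1.
apply: eq_eseriesr => n _; rewrite -poisson_prob_thin// -lawN.
transitivity (\int[P]_(w in D n) (expR (- (a * n%:R)))%:E).
  by apply: eq_integral => w; rewrite inE /D /= => ->.
exact: integral_cst.
Qed.

End poisson_law.

(** * Laplace functional of the Poisson process *)

Lemma lebesgue2_exhaustion (R : realType) : exists D : nat -> set (R * R),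
  [/\ setT = \bigcup_n D n, nondecreasing_seq D &
    forall n, measurable (D n) /\ (lebesgue2 R (D n) < +oo)%E].
Proof.
have /sigma_finiteP[F [FT ndF F_fin]] := @sigma_finiteT _ _ _ (@lebesgue_measure R).
(* Squares of an increasing exhaustion of the line; monotonicity lets one index serve both
   coordinates. *)
exists (fun n => F n `*` F n); split.
- apply/seteqP; split=> // -[x y] _.
  have [m _ Fmx] : (\bigcup_n F n) x by rewrite -FT.
  have [n _ Fny] : (\bigcup_n F n) y by rewrite -FT.
  exists (maxn m n) => //; split => /=.
    by have /subsetPset := ndF _ _ (leq_maxl m n); exact.
  by have /subsetPset := ndF _ _ (leq_maxr m n); exact.
- move=> m n mn; apply/subsetPset; have /subsetPset Fmn := ndF _ _ mn.
  by move=> [x y] [/= /Fmn ? /Fmn].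
- move=> n; have [mF Fy] := F_fin n; split; first exact: measurableX.
  by rewrite product_measure1E// lte_mul_pinfty// ge0_fin_numE.
Qed.

Section poisson_process.
Context (R : realType) d (T : measurableType d) (P : probability T R).
Variables (lambda : R) (E : nat -> T -> R * R).
Hypotheses (lambda_ge0 : (0 <= lambda)%R).
Hypothesis E_poisson : homogeneous_poisson_process P lambda E.
Local Notation mu2 := (lebesgue2 R).
Local Open Scope ereal_scope.

Let mE j : measurable_fun setT (E j). Proof. by case: E_poisson. Qed.

Lemma npointsE (B : set (R * R)) (w : T) :
  npoints E B w = \sum_(0 <= j <oo) (\1_B (E j w))%:E.
Proof.
rewrite /npoints counting_dirac; apply: eq_eseriesr => j _.
by rewrite diracE indicE; congr (_%:R%:E); apply/idP/idP; rewrite !inE.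
Qed.

Lemma npoints_ge0 (B : set (R * R)) (w : T) : 0 <= npoints E B w.
Proof. by rewrite npointsE; apply: nneseries_ge0 => j _ _; rewrite lee_fin. Qed.

Lemma measurable_npoints (B : set (R * R)) : measurable B ->
  measurable_fun setT (npoints E B).
Proof.
move=> mB; rewrite (_ : npoints E B = fun w =>
  \sum_(0 <= j <oo) (\1_B (E j w))%:E); last first.
  by apply/funext => w; exact: npointsE.
apply: ge0_emeasurable_sum => [j x _ _|j _]; first by rewrite lee_fin.
by apply/measurable_EFinP; apply: measurableT_comp => //; exact: measurable_indic.
Qed.

Import HBNNSimple.

Section simple_function.
Variables (f : {nnsfun (R * R)%type >-> R}) (D : set (R * R)).
Hypotheses (mD : measurable D) (D_fin : mu2 D < +oo).

Let s : seq R := fset_set (range f).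
Let B (y : R) : set (R * R) := (f @^-1` [set y]) `&` D.

Let mB y : measurable (B y). Proof. exact: measurableI. Qed.

Let m1B y : measurable_fun setT (\1_(B y) : R * R -> R).
Proof. exact: measurable_indic. Qed.

Let s_uniq : uniq s. Proof. exact: fset_uniq. Qed.

Let mem_s x : f x \in s.
Proof. by rewrite /s in_fset_set//; apply/mem_set; exists x. Qed.

Let s_ge0 y : y \in s -> (0 <= y)%R.
Proof. by rewrite /s in_fset_set// => /set_mem[x _ <-]. Qed.

Let B_fin y : mu2 (B y) < +oo.
Proof.
apply: le_lt_trans D_fin; apply: le_measure; first by rewrite inE; exact: mB.
  by rewrite inE.
exact: subIsetr.
Qed.

(** Values are indexed by ordinals to match the form in which independence of the counts is
    given. *)
Let b (i : 'I_(size s)) : R := s`_i.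

Let b_ge0 i : (0 <= b i)%R. Proof. by apply: s_ge0; exact: mem_nth. Qed.

(** Exactly one level set contains a point of [D], and none contains a point outside, where
    [G 0 = 0] is needed. It is used with the identity for the sum over the points and with 1 -
    exp(-y) for the integral. *)
Let nnsfun_restrict_sum (G : R -> R) (x : R * R) : G 0%R = 0%R ->
  G (f x * \1_D x)%R = (\sum_(i < size s) G (b i) * \1_(B (b i)) x)%R.
Proof.
move=> G0; transitivity (\sum_(y <- s) G y * \1_(B y) x)%R; last first.
  by rewrite (big_nth 0%R) big_mkord.
rewrite (bigD1_seq (f x))//= big1 ?addr0; last first.
  move=> y yfx; rewrite indicE memNset ?mulr0//= => -[/= fxy].
  by rewrite fxy eqxx in yfx.
rewrite /B !indicE in_setI; have -> : x \in f @^-1` [set f x] by rewrite inE.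
by rewrite /=; case: (x \in D); rewrite ?mulr1 ?mulr0.
Qed.

(** The sum over the points is a combination of the counts of the disjoint level sets. These are
    independent and Poisson, so the expectation is a product of Poisson Laplace transforms whose
    exponents add up to the integral. *)
Lemma poisson_process_laplace_simple :
  \int[P]_w expeR (- \sum_(0 <= j <oo) (f (E j w) * \1_D (E j w))%:E) =
  expeR (- (lambda%:E * \int[mu2]_x (1 - expR (- (f x * \1_D x)))%:E)).
Proof.
have sumE w : \sum_(0 <= j <oo) (f (E j w) * \1_D (E j w))%:E =
    \sum_(i < size s) (b i)%:E * npoints E (B (b i)) w.
  under eq_eseriesr do rewrite (@nnsfun_restrict_sum id)// -sumEFin.
  rewrite nneseries_sum; last by move=> i j _; rewrite lee_fin mulr_ge0.
  apply: eq_bigr => i _; rewrite npointsE -nneseriesZl//.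
have e_ge0 i : (0 <= 1 - expR (- b i))%R.
  by rewrite subr_ge0 expR_le1 oppr_le0.
have intE : \int[mu2]_x (1 - expR (- (f x * \1_D x)))%:E =
    \sum_(i < size s) (1 - expR (- b i))%:E * mu2 (B (b i)).
  under eq_integral do rewrite
    (@nnsfun_restrict_sum (fun y => 1 - expR (- y))%R)
      ?oppr0 ?expR0 ?subrr// -sumEFin.
  rewrite ge0_integral_sum//; last 2 first.
  - move=> i; apply/measurable_EFinP/measurable_funM => //.
    exact: m1B.
  - by move=> i x _; rewrite lee_fin mulr_ge0.
  apply: eq_bigr => i _; under eq_integral do rewrite EFinM.
  rewrite ge0_integralZl// ?lee_fin//; last first.
    by apply/measurable_EFinP; exact: m1B.
  by rewrite integral_indic; [rewrite setIT|by []|exact: mB].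
have mphi : measurable_fun setT
    (fun x : R * \bar R => expeR (- (x.1%:E * x.2))).
  apply: measurable_expeRN; apply: emeasurable_funM => //.
  by apply/measurable_EFinP.
have tB : trivIset setT (fun i => B (b i)).
  apply/trivIsetP => i j _ _ ij; apply/seteqP; split=> // x [[/= fi _] [/= fj _]].
  case/negP: ij; rewrite -val_eqE /=.
  rewrite -(nth_uniq 0%R (ltn_ord i) (ltn_ord j) s_uniq).
  by rewrite -/(b i) -/(b j) -fi -fj.
have [_ lawE /(_ _ _ (fun i => mB (b i)) tB) indB] := E_poisson.
have Bfin i : mu2 (B (b i)) = (fine (mu2 (B (b i))))%:E.
  by rewrite fineK// ge0_fin_numE.
have laplaceB i : \int[P]_v expeR (- ((b i)%:E * npoints E (B (b i)) v)) =
    expeR (- (lambda%:E * ((1 - expR (- b i))%:E * mu2 (B (b i))))).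
  rewrite (@poisson_laplace _ _ _ _ _ (lambda * fine (mu2 (B (b i)))))//.
  - by rewrite Bfin -!EFinM /= -mulrA [X in (_ * X)%R]mulrC.
  - by rewrite mulr_ge0// fine_ge0.
  - exact: measurable_npoints.
  - by move=> n; exact: lawE.
rewrite intE ge0_sume_distrr; last first.
  by move=> i _; rewrite mule_ge0// lee_fin.
rewrite -big_enum expeRN_sum; last first.
  by move=> i; rewrite !mule_ge0// lee_fin.
under eq_bigr do rewrite -laplaceB.
(* Only independence of the counts matters here: [J] is empty, the weight is 1 and each [U i] is the
   constant [b i]. *)
have := @integral_prod_indep d T R P _
  (fun i => g_sigma_algebra_preimage (npoints E (B (b i)))) _ _ R (\bar R)
  (fun i => npoints E (B (b i))) (fun x => expeR (- (x.1%:E * x.2)))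
  set0 (enum 'I_(size s)) (fun i => cst (b i)) (cst 1).
move=> /= prodE.
transitivity (\int[P]_w (1 * \prod_(i <- enum 'I_(size s))
    expeR (- ((b i)%:E * npoints E (B (b i)) w)))).
  apply: eq_integral => w _; rewrite mul1e -expeRN_sum ?big_enum ?sumE//.
  by move=> i; rewrite mule_ge0 ?npoints_ge0// lee_fin.
rewrite prodE//.
- under eq_integral do rewrite mul1e.
  by rewrite integral_cst// [X in _ * X]probability_setT mule1.
- by move=> i; apply: sigma_algebra_preimage; exact: sigma_algebra_measurable.
- move=> i _ [C mC <-]; exact: measurable_npoints.
- exact: enum_uniq.
- by move=> i _ [].
- by move=> i _ C mC; exists C => //; rewrite setTI.
- by move=> x; exact: expeR_ge0.
Qed.

End simple_function.

Lemma poisson_process_laplace (h : R * R -> R) :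
  measurable_fun setT h -> (forall x, 0 <= h x)%R ->
  \int[P]_w expeR (- \sum_(0 <= j <oo) (h (E j w))%:E) =
  expeR (- (lambda%:E * \int[mu2]_x (1 - expR (- h x))%:E)).
Proof.
move=> mh h0.
have mh' : measurable_fun setT (EFin \o h) by exact/measurable_EFinP.
have [D [DT ndD D_fin]] := @lebesgue2_exhaustion R.
pose f n := nnsfun_approx measurableT mh' n.
(* Each [h_ n] is a simple function cut off to a set of finite measure, as in the simple case, and
   these functions increase to [h]. *)
pose h_ n (x : R * R) := (f n x * \1_(D n) x)%R.
have mh_ n : measurable_fun setT (h_ n).
  by apply: measurable_funM => //; apply: measurable_indic; case: (D_fin n).
have h_0 n x : (0 <= h_ n x)%R by rewrite mulr_ge0.
have ndh x m n : (m <= n)%N -> (h_ m x <= h_ n x)%R.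
  move=> mn; apply: ler_pM => //.
    exact/lefP/nd_nnsfun_approx.
  have /subsetPset DD := ndD _ _ mn.
  rewrite !indicE ler_nat; case: (boolP (x \in D m)) => //=.
  by move=> /set_mem/DD Dnx; rewrite mem_set.
have cvgh x : (h_ n x)%:E @[n --> \oo] --> (h x)%:E.
  have /= := cvg_nnsfun_approx measurableT mh' (fun x _ => h0 x) (I : setT x).
  apply: cvg_trans; apply: near_eq_cvg.
  have [k _ Dkx] : (\bigcup_k D k) x by rewrite -DT.
  exists k => // n /= kn; rewrite /h_ indicE mem_set ?mulr1//.
  by have /subsetPset := ndD _ _ kn; exact.
(* As an integral against the counting measure, the sum over the points is subject to monotone
   convergence, even if its limit is infinite. *)
have cvgsum w : \sum_(0 <= j <oo) (h_ n (E j w))%:E @[n --> \oo] -->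
    \sum_(0 <= j <oo) (h (E j w))%:E.
  rewrite -ge0_integral_count; last by move=> j; rewrite lee_fin h0.
  rewrite [X in X @ _ --> _](_ : _ = fun n =>
      \int[counting]_j (h_ n (E j w))%:E); last first.
    apply/funext => n; rewrite ge0_integral_count// => j.
    by rewrite lee_fin h_0.
  rewrite (_ : (fun j => (h (E j w))%:E) =
    (fun j => limn (fun n => (h_ n (E j w))%:E))); last first.
    by apply/funext => j; apply/esym/cvg_lim.
  apply: cvg_monotone_convergence => //.
  - by move=> n j _; rewrite lee_fin.
  - by move=> j _ m n mn; rewrite lee_fin ndh.
have cvgint : \int[mu2]_x (1 - expR (- h_ n x))%:E @[n --> \oo] -->
    \int[mu2]_x (1 - expR (- h x))%:E.
  rewrite (_ : (fun x => (1 - expR (- h x))%:E) =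
    (fun x => limn (fun n => (1 - expR (- h_ n x))%:E))); last first.
    apply/funext => x; apply/esym/cvg_lim => //.
    have /fine_cvgP[_ hx] := cvgh x.
    apply: cvg_EFin; first exact: nearW.
    apply: cvgB; first exact: cvg_cst.
    by apply: continuous_cvg; [exact: continuous_expR|exact: cvgN hx].
  apply: cvg_monotone_convergence => //.
  - move=> n; apply/measurable_EFinP/measurable_funB => //.
    apply: (measurableT_comp (@measurable_expR R)).
    exact: (measurable_funN (mh_ n)).
  - by move=> n x _; rewrite lee_fin subr_ge0 expR_le1 oppr_le0.
  - by move=> x _ m n mn; rewrite lee_fin lerD2l lerN2 ler_expR lerN2 ndh.
have lim1 : \int[P]_w expeR (- \sum_(0 <= j <oo) (h_ n (E j w))%:E)
    @[n --> \oo] --> \int[P]_w expeR (- \sum_(0 <= j <oo) (h (E j w))%:E).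
  apply: cvg_integral_expeRN => // [n|n w].
    apply: ge0_emeasurable_sum => [j x _ _|j _]; first by rewrite lee_fin.
    by apply/measurable_EFinP; exact: measurableT_comp.
  by apply: nneseries_ge0 => j _ _; rewrite lee_fin.
apply: (cvg_unique _ lim1) => //.
rewrite (_ : (fun n => _) = fun n =>
  expeR (- (lambda%:E * \int[mu2]_x (1 - expR (- h_ n x))%:E))); last first.
  by apply/funext => n; case: (D_fin n) => mD Dy; exact: poisson_process_laplace_simple.
apply: cvg_expeRN => [n|]; last exact: cvgeZl.
rewrite mule_ge0 ?lee_fin//; apply: integral_ge0 => x _.
by rewrite lee_fin subr_ge0 expR_le1 oppr_le0.
Qed.

End poisson_process.

(** * The secure connection event and the interference *)

Lemma sqmag_ge0 (R : realType) (z : R[i]) : 0 <= sqmag z.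
Proof. exact: sqr_ge0. Qed.

Lemma log2e_gt0 (R : realType) (x : \bar R) : (0 < log2e x)%E = (1 < x)%E.
Proof.
have ln2 : 0 < ln 2 :> R by rewrite ln_gt0// ltr1n.
by rewrite /log2e inver gt_eqF// lte_pdivlMr// mul0e lne_gt0.
Qed.

(** For finite [y], multiply by the positive denominator. For [y] = +oo the ratio is 0 because the
    inverse of +oo is 0, so both comparisons fail. *)
Lemma snr_ratio_gt1 (R : realType) (x y : \bar R) : (0 <= y)%E ->
  (1 < (1 + x) / (1 + y))%E = (y < x)%E.
Proof.
case: y => [y| |//] y0; last first.
  by rewrite addey// invey mule0 [RHS]ltNge leey lte_fin ltr10.
rewrite lee_fin in y0; have y1 : 0 < 1 + y by rewrite ltr_wpDr.
rewrite -EFinD inver gt_eqF// lte_pdivlMr// mul1e EFinD.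
by rewrite lteD2lE.
Qed.

Lemma eucl_dist_gt0 (R : realType) (x y : R * R) : x != y -> 0 < eucl_dist x y.
Proof.
move=> xy; rewrite /eucl_dist sqrtr_gt0 lt_neqAle addr_ge0 ?sqr_ge0// andbT.
rewrite eq_sym paddr_eq0 ?sqr_ge0// !sqrf_eq0 !subr_eq0.
by apply: contra xy => /andP[/eqP x1 /eqP x2]; apply/eqP/injective_projections.
Qed.

Lemma measurable_eucl_dist_powR_inv (R : realType) (a : R) (x : R * R) :
  measurable_fun setT (fun y => (eucl_dist x y `^ a)^-1).
Proof.
(* Writing the square root and the inverse as real powers reduces the claim to measurability of
   [powR], used three times. *)
rewrite (_ : (fun y => _) = fun y : R * R =>
  (((x.1 - y.1) ^+ 2 + (x.2 - y.2) ^+ 2) `^ 2^-1) `^ a `^ (-1)); last first.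
  apply/funext => y; rewrite powR_inv1 ?powR_ge0// powR12_sqrt//.
  by rewrite addr_ge0 ?sqr_ge0.
apply: (measurableT_comp (@measurable_powR R _)).
apply: (measurableT_comp (@measurable_powR R _)).
apply: (measurableT_comp (@measurable_powR R _)).
by apply: measurable_funD; apply: measurable_funX; apply: measurable_funB.
Qed.

Section network_events.
Context (T : Type) (R : realType) (N : nat).
Variables (alpha : R) (A : 'I_N.+1 -> R * R) (p : 'I_N -> R).
Variables (hL : 'I_N -> T -> R[i]) (hE : 'I_N -> nat -> T -> R[i]).
Variable E : nat -> T -> R * R.
Hypotheses (N_gt0 : (0 < N)%N) (A_inj : injective A) (p_gt0 : forall i, 0 < p i).

Lemma hop_loss_gt0 (i : 'I_N) : 0 < hop_loss alpha A i.
Proof.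
apply: powR_gt0; apply: eucl_dist_gt0; apply/eqP => /A_inj/(congr1 val) /=.
by rewrite /bump leq0n add1n => /eqP; rewrite ltn_eqF.
Qed.

Lemma eavesdropper_snr_ge0 (w : T) : (0 <= eavesdropper_snr alpha A p hE E w)%E.
Proof.
apply: nneseries_ge0 => j _ _; apply: sume_ge0 => k _.
rewrite lee_fin divr_ge0 ?powR_ge0//.
by apply: mulr_ge0; [exact: ltW|exact: sqmag_ge0].
Qed.

Lemma colluding_secure_connectionP (w : T) :
  colluding_secure_connection alpha A p hL hE E w <->
  forall i, ((hop_loss alpha A i / p i)%:E * eavesdropper_snr alpha A p hE E w <
             (sqmag (hL i w))%:E)%E.
Proof.
rewrite /colluding_secure_connection /= log2e_gt0.
rewrite snr_ratio_gt1; last exact: eavesdropper_snr_ge0.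
have hopE i (y : \bar R) : (y < (p i * sqmag (hL i w) / hop_loss alpha A i)%:E)%E =
    ((hop_loss alpha A i / p i)%:E * y < (sqmag (hL i w))%:E)%E.
  by rewrite mulrAC EFinM -lte_pdivrMl ?divr_gt0 ?hop_loss_gt0// invf_div.
split=> [/bigmin_gtP[_ min_gt] i|hop_gt].
  by rewrite -hopE; exact: min_gt.
(* The minimum starts from +oo, so the interference must also be below +oo. Any hop shows this, and
   [N_gt0] provides one. *)
apply/bigmin_gtP; split=> [|i _]; last by rewrite hopE.
have := hop_gt (Ordinal N_gt0).
by rewrite -hopE => /lt_le_trans; apply; exact: leey.
Qed.

End network_events.

(** The sigma-algebra on [T] is left arbitrary: the main proof needs the full one and also the one
    generated by the process and the eavesdropper gains. *)
Lemma measurable_eavesdropper_snr d (T : measurableType d) (R : realType)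
    (N : nat) (alpha : R) (A : 'I_N.+1 -> R * R) (p : 'I_N -> R)
    (hE : 'I_N -> nat -> T -> R[i]) (E : nat -> T -> R * R) :
  (forall i, 0 < p i) -> (forall j, measurable_fun setT (E j)) ->
  (forall k j, measurable_fun setT (fun w => sqmag (hE k j w))) ->
  measurable_fun setT (eavesdropper_snr alpha A p hE E).
Proof.
move=> p_gt0 mE mh; apply: ge0_emeasurable_sum => [j w _ _|j _].
  apply: sume_ge0 => k _.
  rewrite lee_fin divr_ge0 ?powR_ge0//.
  by apply: mulr_ge0; [exact: ltW|exact: sqmag_ge0].
apply: emeasurable_sum => k; apply/measurable_EFinP/measurable_funM.
  exact: measurable_funM.
exact: (measurableT_comp (measurable_eucl_dist_powR_inv alpha (transmitter A k))).
Qed.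

(** An extended threshold is allowed because the interference may be infinite; at +oo both sides are
    0. *)
Lemma exponential_mean1_integral_gt d (T : measurableType d) (R : realType)
    (P : probability T R) (X : T -> R) (u : \bar R) :
  exponential_mean1 P X -> (0 <= u)%E ->
  (\int[P]_w ((u < (X w)%:E)%E%:R)%:E = expeR (- u))%E.
Proof.
move=> X_exp; case: u => [r| |//] u0; last first.
  by rewrite integral0_eq// => w _; rewrite ltNge leey.
rewrite lee_fin in u0.
have mgt : measurable [set w | r < X w].
  have mlt : measurable_fun setT (fun w => r < X w).
    by apply: measurable_fun_ltr => //; case: X_exp.
  by rewrite -[X in measurable X]setTI; apply: (mlt _ [set true]).
transitivity (\int[P]_w (\1_[set w | r < X w] w)%:E)%E.
  apply: eq_integral => w _; rewrite lte_fin indicE.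
  suff -> : (w \in [set w | r < X w]) = (r < X w) by [].
  by apply/idP/idP; rewrite inE.
by rewrite integral_indic// setIT; exact: exponential_mean1_gt.
Qed.

(** * The secure connection probability *)

Theorem mainTheorem1 (d : measure_display) (T : measurableType d) (R : realType)
  (P : probability T R) (alpha lambda : R) (N : nat)
  (A : 'I_N.+1 -> R * R) (p : 'I_N -> R)
  (hL : 'I_N -> T -> R[i]) (hE : 'I_N -> nat -> T -> R[i])
  (E : nat -> T -> R * R)
  (alpha_gt2 : 2 < alpha) (lambda_gt0 : 0 < lambda) (N_ge1 : (1 <= N)%N)
  (A_inj : injective A) (p_gt0 : forall i, 0 < p i)
  (E_poisson : homogeneous_poisson_process P lambda E)
  (gain_exp : forall c, exponential_mean1 P (channel_gain hL hE c))
  (indep : mutually_independent P (process_gain_sigma hL hE E)) :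
  P (colluding_secure_connection alpha A p hL hE E) =
  expeR (- (lambda%:E *
    \int[lebesgue2 R]_x
      (1 - \prod_(k < N)
             (1 / (1 + p k / eucl_dist (transmitter A k) x `^ alpha *
                       \sum_(i < N) hop_loss alpha A i / p i)))%:E))%E.
Proof.
have [mE _ _] := E_poisson.
set F := process_gain_sigma hL hE E in indep.
(* The value at [None], the index of the process, is a placeholder: only gains are integrated
   out. *)
pose g (o : option ('I_N + 'I_N * nat)) : T -> R :=
  if o is Some c then channel_gain hL hE c else cst 0.
have g_ge0 o w : 0 <= g o w by case: o => [[i|[k j]]|]//; exact: sqmag_ge0.
have mchannel c : measurable_fun setT (channel_gain hL hE c).
  by case: (gain_exp c).
have sF o : sigma_algebra setT (F o).
  case: o => [c|]; last exact: smallest_sigma_algebra.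
  by apply: sigma_algebra_preimage; exact: sigma_algebra_measurable.
have mF o : F o `<=` measurable.
  case: o => [c|]; first by move=> _ [B mB <-]; exact: mchannel.
  apply: smallest_sub; first exact: sigma_algebra_measurable.
  by move=> _ [j _ [B mB <-]]; exact: mE.
have Fg c B : measurable B -> F (Some c) (g (Some c) @^-1` B).
  by move=> mB; exists B => //; rewrite setTI.
have FE j B : measurable B -> F None (E j @^-1` B).
  move=> mB; apply: sub_sigma_algebra; exists j => //; exists B => //.
  by rewrite setTI.
pose c i := hop_loss alpha A i / p i.
have c_gt0 i : 0 < c i by rewrite divr_gt0// hop_loss_gt0.
pose S := \sum_(i < N) c i.
have S_ge0 : 0 <= S by rewrite sumr_ge0// => i _; exact: ltW.
pose snr := eavesdropper_snr alpha A p hE E.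
have snr_ge0 w : (0 <= snr w)%E by exact: eavesdropper_snr_ge0.
have msnr : measurable_fun setT snr.
  by apply: measurable_eavesdropper_snr => // k j; exact: (mchannel (inr (k, j))).
(* At a transmitter [dinv] is 0 by the convention on inverses. The integrand of the theorem follows
   the same convention, so the final identity holds at every [x]. *)
pose dinv k x := (eucl_dist (transmitter A k) x `^ alpha)^-1.
have dinv_ge0 k x : 0 <= dinv k x by rewrite invr_ge0 powR_ge0.
have mdinv k : measurable_fun setT (dinv k).
  exact: measurable_eucl_dist_powR_inv.
pose H k x := S * (p k * dinv k x).
have H_ge0 k x : 0 <= H k x by rewrite !mulr_ge0// ltW.
have mH k : measurable_fun setT (H k).
  by apply: measurable_funM => //; exact: measurable_funM.
(* Chosen so that exp(-[h x]) is the product over [k] of 1 / (1 + [H k x]). *)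
pose h x := \sum_(k < N) ln (1 + H k x).
have h_ge0 x : 0 <= h x by rewrite sumr_ge0// => k _; rewrite ln_ge0// lerDl.
have mh : measurable_fun setT h.
  apply: measurable_sum => k; apply: measurableT_comp => //.
  exact: measurable_funD.
(* Partial sums of [S] times the interference: the factor [S] is already contained in [H]. *)
pose snr_ n w := (\sum_(0 <= j < n) \sum_(k < N)
  (H k (E j w) * sqmag (hE k j w))%:E)%E.
have stepA : P (colluding_secure_connection alpha A p hL hE E) =
    (\int[P]_w expeR (- (S%:E * snr w)))%E.
  (* [J] keeps the process and the eavesdropper gains, which determine the interference, and leaves
     out the hop gains to be integrated out. *)
  pose J : set (option ('I_N + 'I_N * nat)) :=
    [set o | if o is Some (inl _) then False else True].
  pose TJ := g_sigma_algebraType (\bigcup_(o in J) F o).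
  have msnrJ : measurable_fun (setT : set TJ) snr.
    apply: (@measurable_eavesdropper_snr _ TJ) => // [j|k j].
      by apply: (@measurable_joint_sigma1 _ _ _ _ _ _ _ None) => //; exact: FE.
    apply: (@measurable_joint_sigma1 _ _ _ _ _ _ _ (Some (inr (k, j)))) => // B.
    exact: Fg.
  pose phi (x : \bar R * R) : \bar R := (((x.1 < x.2%:E)%E)%:R)%:E.
  pose U (o : option ('I_N + 'I_N * nat)) : TJ -> \bar R :=
    if o is Some (inl i) then (fun w => (c i)%:E * snr w)%E else cst 0%E.
  have mphi : measurable_fun setT phi.
    rewrite (_ : phi = EFin \o \1_[set x : \bar R * R | (x.1 < x.2%:E)%E]).
      apply/measurable_EFinP; apply: measurable_indic.
      rewrite -[X in measurable X]setTI; apply: measurable_lte => //.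
      by apply/measurable_EFinP.
    apply/funext => x; rewrite /phi /= indicE.
    suff -> : (x \in [set x : \bar R * R | (x.1 < x.2%:E)%E]) =
      (x.1 < x.2%:E)%E by [].
    by apply/idP/idP; rewrite inE.
  (* The indicator of the event is the product over the hops of the indicators that [c i] times the
     interference is below the gain of hop [i]. *)
  transitivity (\int[P]_w (cst 1 w *
      \prod_(o <- [seq Some (inl i) | i <- enum 'I_N]) phi (U o w, g o w)))%E.
    have mgt i : measurable
        [set w | ((c i)%:E * snr w < (sqmag (hL i w))%:E)%E].
      rewrite -[X in measurable X]setTI; apply: measurable_lte => //.
        exact: emeasurable_funM.
      by apply/measurable_EFinP; exact: (mchannel (inl i)).
    set ev := colluding_secure_connection _ _ _ _ _ _.
    have evP w : ev w <-> forall i, ((c i)%:E * snr w < (sqmag (hL i w))%:E)%E.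
      exact: colluding_secure_connectionP.
    have mev : measurable ev.
      rewrite (_ : ev = \bigcap_(i in [set: 'I_N])
          [set w | ((c i)%:E * snr w < (sqmag (hL i w))%:E)%E]).
        by apply: fin_bigcap_measurable => // i _; exact: mgt.
      by apply/seteqP; split=> w; [move=> /evP + i _; apply|
        move=> evw; apply/evP => i; exact: evw].
    transitivity (\int[P]_w (\1_ev w)%:E)%E.
      by rewrite integral_indic// setIT.
    apply: eq_integral => w _; rewrite /= mul1e big_map big_enum/= indicE.
    have [/evP evw|evw] := pselect (ev w).
      by rewrite mem_set; [rewrite big1// => i _; rewrite /phi /= evw|exact/evP].
    rewrite memNset//; have /existsNP[i /negP gi] : ~ forall i,
      ((c i)%:E * snr w < (sqmag (hL i w))%:E)%E by move=> /evP.
    by rewrite (bigD1 i)//= {1}/phi /= (negbTE gi) mul0e.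
  rewrite (integral_prod_indep (J := J) sF mF indep)//.
  - apply: eq_integral => w _; rewrite /= mul1e big_map big_enum/=.
    have -> : (S%:E * snr w = \sum_(i < N) (c i)%:E * snr w)%E.
      by rewrite -ge0_sume_distrl ?sumEFin// => i _; rewrite lee_fin ltW.
    rewrite -big_enum expeRN_sum => [|i]; last by rewrite mule_ge0// lee_fin ltW.
    rewrite big_enum; apply: eq_bigr => i _.
    apply: exponential_mean1_integral_gt; first exact: (gain_exp (inl i)).
    by rewrite mule_ge0// lee_fin ltW.
  - by rewrite map_inj_uniq ?enum_uniq// => i j [].
  - by move=> _ /mapP[i _ ->] [].
  - by move=> _ /mapP[i _ ->] B; exact: Fg.
  - by move=> x; rewrite lee_fin ler0n.
  - move=> [[i|[k j]]|]; rewrite /U; [|exact: measurable_cst|exact: measurable_cst].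
    exact: emeasurable_funM.
(* The product lemma handles finitely many variables, so the eavesdropper gains are integrated out
   for the first [n] points only. Here the retained sigma-algebra is that of the process alone. *)
have stepB n : (\int[P]_w expeR (- snr_ n w) =
    \int[P]_w expeR (- \sum_(0 <= j < n) (h (E j w))%:E))%E.
  pose s : seq (option ('I_N + 'I_N * nat)) :=
    [seq Some (inr (k, j)) | j <- index_iota 0 n, k <- enum 'I_N].
  pose TE := g_sigma_algebraType (\bigcup_(o in [set None]) F o).
  pose U (o : option ('I_N + 'I_N * nat)) : TE -> R :=
    if o is Some (inr (k, j)) then (fun w => H k (E j w)) else cst 0.
  have U_ge0 o w : 0 <= U o w by case: o => [[i|[k j]]|] //=; exact: H_ge0.
  pose phi (x : R * R) : \bar R := (expR (- (x.1 * x.2)))%:E.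
  have mphi : measurable_fun setT phi.
    apply/measurable_EFinP; apply: (measurableT_comp (@measurable_expR R)).
    by apply: measurable_funN; exact: measurable_funM.
  have sum_s (G : option ('I_N + 'I_N * nat) -> \bar R) :
    (\sum_(o <- s) G o = \sum_(0 <= j < n) \sum_(k < N) G (Some (inr (k, j))))%E.
    by rewrite big_allpairs_dep; apply: eq_bigr => j _; rewrite big_enum.
  transitivity (\int[P]_w (cst 1 w * \prod_(o <- s) phi (U o w, g o w)))%E.
    apply: eq_integral => w _; rewrite /= mul1e /snr_.
    rewrite -(sum_s (fun o => (U o w * g o w)%:E)) expeRN_sum// => o.
    by rewrite lee_fin mulr_ge0.
  rewrite (integral_prod_indep (J := [set None]) sF mF indep)//.
  - apply: eq_integral => w _; rewrite /= mul1e.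
    transitivity (expeR (- \sum_(o <- s) (ln (1 + U o w))%:E))%E; last first.
      rewrite sum_s; congr (expeR (- _))%E; apply: eq_bigr => j _.
      by rewrite sumEFin.
    rewrite expeRN_sum => [|o]; last by rewrite lee_fin ln_ge0// lerDl.
    apply: eq_big_seq => _ /allpairsP[[j k] [_ _ ->]].
    (* The average over one gain is 1 / (1 + [H k (E j w)]), which is the exponential of minus its
       summand in [h (E j w)]. *)
    rewrite [LHS](exponential_mean1_laplace (gain_exp (inr (k, j))))//.
    + by rewrite /= expRN lnK// posrE ltr_wpDr.
    + by move=> v; exact: (g_ge0 (Some (inr (k, j)))).
  - apply: allpairs_uniq; [exact: iota_uniq|exact: enum_uniq|].
    by move=> [j k] [j' k'] _ _ [-> ->].
  - by move=> _ /allpairsP[[j k] [_ _ ->]].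
  - by move=> _ /allpairsP[[j k] [_ _ ->]] B; exact: Fg.
  - by move=> x; rewrite lee_fin expR_ge0.
  - move=> [[i|[k j]]|]; rewrite /U; [exact: measurable_cst| |exact: measurable_cst].
    apply: measurableT_comp => //.
    by apply: (@measurable_joint_sigma1 _ _ _ _ _ _ _ None) => //; exact: FE.
have limA : (\int[P]_w expeR (- snr_ n w) @[n --> \oo] -->
    \int[P]_w expeR (- (S%:E * snr w)))%E.
  apply: cvg_integral_expeRN => [n|n w|w].
  - apply: emeasurable_sum => j; apply: emeasurable_sum => k.
    apply/measurable_EFinP/measurable_funM; first exact: measurableT_comp.
    exact: (mchannel (inr (k, j))).
  - apply: sume_ge0 => j _; apply: sume_ge0 => k _.
    by rewrite lee_fin mulr_ge0// sqmag_ge0.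
  - have term_ge0 k j : 0 <= p k * sqmag (hE k j w) * dinv k (E j w).
      by rewrite mulr_ge0// mulr_ge0 ?sqmag_ge0// ltW.
    rewrite /snr /eavesdropper_snr -nneseriesZl; last first.
      by move=> j _; apply: sume_ge0 => k _; rewrite lee_fin; exact: term_ge0.
    rewrite (_ : snr_^~ w = fun n => (\sum_(0 <= j < n) (S%:E * \sum_(k < N)
      (p k * sqmag (hE k j w) * dinv k (E j w))%:E))%E).
      apply: is_cvg_nneseries => j _ _; rewrite mule_ge0 ?lee_fin//.
      by apply: sume_ge0 => k _; rewrite lee_fin.
    apply/funext => n; apply: eq_bigr => j _; rewrite ge0_sume_distrr; last first.
      by move=> k _; rewrite lee_fin.
    by apply: eq_bigr => k _; rewrite -EFinM /H; congr EFin; ring.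
have limB : (\int[P]_w expeR (- \sum_(0 <= j < n) (h (E j w))%:E) @[n --> \oo] -->
    \int[P]_w expeR (- \sum_(0 <= j <oo) (h (E j w))%:E))%E.
  apply: cvg_integral_expeRN => [n|n w|w].
  - by apply: emeasurable_sum => j; apply/measurable_EFinP; exact: measurableT_comp.
  - by apply: sume_ge0 => j _; rewrite lee_fin.
  - by apply: is_cvg_nneseries => j _ _; rewrite lee_fin.
have -> : P (colluding_secure_connection alpha A p hL hE E) =
    (\int[P]_w expeR (- \sum_(0 <= j <oo) (h (E j w))%:E))%E.
  (* By [stepB] the sequences in [limA] and [limB] are the same, hence so are their limits. *)
  rewrite stepA; apply: (cvg_unique _ limA) => //.
  by rewrite (funext stepB).
rewrite (poisson_process_laplace (ltW lambda_gt0) E_poisson mh h_ge0).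
congr (expeR (- (_ * _))%E); apply: eq_integral => x _; congr (1 - _)%:E.
rewrite -sumrN expR_sum; apply: eq_bigr => k _.
rewrite expRN lnK ?posrE ?ltr_wpDr// div1r; congr (1 + _)^-1.
by rewrite /H mulrC.
Qed.
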